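(* Let $k$ be an algebraically closed field of characteristic zero and let $q\in k$ with $q^i\neq1$ for every nonzero integer $i$. Let $f\in k(t,x)$ be such that, over the algebraic closure $\overline{k(t)}$ of $k(t)$, $$f=c+\sum_{i=1}^m\sum_{j=1}^{n_i}\frac{\alpha_{i,j}}{(x-\beta_i)^j},$$ where $c\in k(t)$, $\alpha_{i,j},\beta_i\in\overline{k(t)}$, $\alpha_{i,n_i}\neq 0$ for each $i$, and the $\beta_i$ lie in distinct $q^{\mathbb{Z}}$-orbits (i.e. there is no $i\neq i'$ and $n\in\mathbb{Z}$ with $\beta_i=q^n\beta_{i'}$). Then there exist a nonzero operator $L\in k(t)\langle D_t\rangle$ and $g\in k(t,x)$ with $L(f)=\Delta_{q,x}(g)$ if and only if all the $\beta_i$ lie in $k$.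
   Context: $D_t=\partial/\partial t$; $Q_x(h(t,x))=h(t,qx)$ and $\Delta_{q,x}=Q_x-1$. $k(t)\langle D_t\rangle$ is the ring of linear differential operators $\sum_\ell e_\ell D_t^\ell$ with $e_\ell\in k(t)$, acting on $k(t,x)$. *)

(* Defs.v *)
From HB Require Import structures.
From mathcomp Require Import all_boot all_order all_algebra.
From mathcomp Require Import ring.

Set Implicit Arguments.
Unset Strict Implicit.
Unset Printing Implicit Defensive.

Import GRing.Theory.
Local Open Scope ring_scope.
Local Open Scope quotient_scope.

Notation "x %:F" := (@FracField.tofrac _ x) : ring_scope.
Notation ratfun F := {fraction {poly F}}.

Lemma quotient_rule_add (F : fieldType) (a b x y a' b' x' y' : F) :
  b != 0 -> b' != 0 ->
  (((x * b' + a * y') + (x' * b + a' * y)) * (b * b')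
    - (a * b' + a' * b) * (y * b' + b * y')) / (b * b') ^+ 2
  = (x * b - a * y) / b ^+ 2 + (x' * b' - a' * y') / b' ^+ 2.
Proof. by move=> b0 b'0; field; rewrite b0 b'0. Qed.

Lemma quotient_rule_mul (F : fieldType) (a b x y a' b' x' y' : F) :
  b != 0 -> b' != 0 ->
  ((x * a' + a * x') * (b * b') - a * a' * (y * b' + b * y')) / (b * b') ^+ 2
  = (x * b - a * y) / b ^+ 2 * (a' / b') + a / b * ((x' * b' - a' * y') / b' ^+ 2).
Proof. by move=> b0 b'0; field; rewrite b0 b'0. Qed.

Section Fractions.
Variable R : idomainType.
Implicit Types (a b : R) (u v : {fraction R}).

(* [repr u] is a chosen pair (numerator, denominator) representing [u]; the
   two constructions below do not depend on it, see [frac_liftE] and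
   [frac_derE]. *)
Definition frac_lift (F : fieldType) (phi : R -> F) u : F :=
  phi \n_(repr u) / phi \d_(repr u).

Definition frac_der (d : R -> R) u : {fraction R} :=
  let a := \n_(repr u) in let b := \d_(repr u) in
  (d a * b - a * d b)%:F / (b ^+ 2)%:F.

Lemma repr_den_neq0 u : \d_(repr u) != 0.
Proof. exact: denom_ratioP. Qed.

Lemma frac_reprE u : u = (\n_(repr u))%:F / (\d_(repr u))%:F.
Proof.
set r := repr u; have -> : u = \pi_{fraction R} r by rewrite /r reprK.
have d0 : (\d_r)%:F != 0 :> {fraction R} by rewrite tofrac_eq0 denom_ratioP.
apply: (mulIf d0); rewrite mulfVK //.
unlock FracField.tofrac => /=.
rewrite -[LHS]FracField.pi_mul; apply/eqmodP; rewrite /=.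
rewrite /FracField.equivf /FracField.mulf.
rewrite !numden_Ratio ?mulf_neq0 ?denom_ratioP ?oner_neq0 //.
by rewrite !mulr1 mulrC.
Qed.

Lemma repr_cross a b : b != 0 ->
  \n_(repr (a%:F / b%:F)) * b = a * \d_(repr (a%:F / b%:F)).
Proof.
move=> b0; have := frac_reprE (a%:F / b%:F); move: (repr_den_neq0 (a%:F / b%:F)).
move: (\n_ _) (\d_ _) => n d d0 /eqP.
rewrite eqr_div ?tofrac_eq0 // -!tofracM tofrac_eq => /eqP ->.
by [].
Qed.

Lemma frac_liftE (F : fieldType) (phi : {rmorphism R -> F}) a b :
  injective phi -> b != 0 -> frac_lift phi (a%:F / b%:F) = phi a / phi b.
Proof.
move=> phiI b0; have nz c : c != 0 -> phi c != 0.
  by move=> c0; rewrite -(rmorph0 phi) (inj_eq phiI).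
apply/eqP; rewrite /frac_lift eqr_div ?nz ?repr_den_neq0 //.
by rewrite -!rmorphM repr_cross.
Qed.

Lemma frac_derE (d : R -> R) a b :
  (forall x y, d (x * y) = d x * y + x * d y) -> b != 0 ->
  frac_der d (a%:F / b%:F) = (d a * b - a * d b)%:F / (b ^+ 2)%:F.
Proof.
move=> dM b0; rewrite /frac_der; have e := repr_cross a b0.
have n0 := repr_den_neq0 (a%:F / b%:F); move: (\n_ _) (\d_ _) e n0 => n m e m0.
have de : d n * b + n * d b = d a * m + a * d m by rewrite -!dM e.
apply/eqP; rewrite eqr_div ?tofrac_eq0 ?expf_neq0 // -!tofracM tofrac_eq.
rewrite eq_sym -subr_eq0; apply/eqP.
transitivity (b * m * ((d a * m + a * d m) - (d n * b + n * d b))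
              + (d b * m + d m * b) * (n * b - a * m)); first by ring.
by rewrite de e !subrr !mulr0 addr0.
Qed.

End Fractions.

Definition frac_cst (F : fieldType) (c : F) : ratfun F := c%:P%:F.

Definition frac_map (F E : fieldType) (h : F -> E) : ratfun F -> ratfun E :=
  frac_lift (fun p => (map_poly h p)%:F).

Section Operators.
Variable k : fieldType.

Notation kt := (ratfun k).
Notation ktx := (ratfun (ratfun k)).

(* [D_t] on k(t), then its extension to k(t)(x) with [D_t x = 0]. *)
Definition Dt : kt -> kt := frac_der (@deriv k).
Definition Dtx : ktx -> ktx := frac_der (map_poly Dt).

Definition Qx (q : k) : ktx -> ktx :=
  frac_lift (fun p => (p \Po (frac_cst q *: 'X))%:F).

Definition Deltax (q : k) (h : ktx) : ktx := Qx q h - h.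

(* The operator \sum_l e_l D_t^l is encoded by the polynomial with
   coefficients e_l; only the underlying left k(t)-module is used, the product
   of [{poly kt}] is not the product of operators. *)
Definition diffop := {poly kt}.

Definition diffop_app (L : diffop) (h : ktx) : ktx :=
  \sum_(l < size L) frac_cst L`_l * iter l Dtx h.

End Operators.

Section Quotients.
Variables (R : idomainType) (d : R -> R).
Hypotheses (dD : forall x y, d (x + y) = d x + d y)
           (dM : forall x y, d (x * y) = d x * y + x * d y).

Lemma frac_derD u v : frac_der d (u + v) = frac_der d u + frac_der d v.
Proof.
rewrite (frac_reprE u) (frac_reprE v).
move: (repr_den_neq0 u) (repr_den_neq0 v).
move: (\n_ _) (\d_ _) (\n_ _) (\d_ _) => a b a' b' b0 b'0.
have [B0 B'0] : b%:F != 0 /\ b'%:F != 0 by rewrite !tofrac_eq0.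
rewrite addf_div // -!tofracM -tofracD !frac_derE ?mulf_neq0 // dD !dM.
rewrite !(tofracB, tofracM, tofracD, tofracXn).
exact: quotient_rule_add.
Qed.

Lemma frac_derM u v :
  frac_der d (u * v) = frac_der d u * v + u * frac_der d v.
Proof.
rewrite (frac_reprE u) (frac_reprE v).
move: (repr_den_neq0 u) (repr_den_neq0 v).
move: (\n_ _) (\d_ _) (\n_ _) (\d_ _) => a b a' b' b0 b'0.
have [B0 B'0] : b%:F != 0 /\ b'%:F != 0 by rewrite !tofrac_eq0.
rewrite mulf_div -!tofracM !frac_derE ?mulf_neq0 // !dM.
rewrite !(tofracB, tofracM, tofracD, tofracXn).
exact: quotient_rule_mul.
Qed.

End Quotients.

Section OperatorQuotients.
Variable k : fieldType.

Lemma Dt_quot (a b : {poly k}) : b != 0 ->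
  Dt (a%:F / b%:F) = (a^`() * b - a * b^`())%:F / (b ^+ 2)%:F.
Proof. by apply: frac_derE => x y; rewrite derivM. Qed.

Lemma DtD : {morph @Dt k : u v / u + v}.
Proof. by apply: frac_derD => x y; rewrite (derivD, derivM). Qed.

Lemma DtM u v : @Dt k (u * v) = Dt u * v + u * Dt v.
Proof. by apply: frac_derM => x y; rewrite derivM. Qed.

Lemma Dt0 : @Dt k 0 = 0.
Proof. by apply: (addrI (Dt 0)); rewrite -DtD !addr0. Qed.

Lemma coef_map_Dt (p : {poly ratfun k}) i :
  (map_poly (@Dt k) p)`_i = Dt p`_i.
Proof. by rewrite coef_map_id0 ?Dt0. Qed.

Lemma map_DtD : {morph map_poly (@Dt k) : p r / p + r}.
Proof. by move=> p r; apply/polyP => i; rewrite !(coefD, coef_map_Dt) DtD. Qed.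

Lemma map_DtM (p r : {poly ratfun k}) :
  map_poly (@Dt k) (p * r) = map_poly (@Dt k) p * r + p * map_poly (@Dt k) r.
Proof.
apply/polyP => i; rewrite coefD coef_map_Dt !coefM.
rewrite (big_morph _ DtD Dt0) -big_split; apply: eq_bigr => j _ /=.
by rewrite DtM !coef_map_Dt.
Qed.

Lemma Dtx_quot (a b : {poly ratfun k}) : b != 0 ->
  Dtx (a%:F / b%:F) =
  (map_poly (@Dt k) a * b - a * map_poly (@Dt k) b)%:F / (b ^+ 2)%:F.
Proof. exact/frac_derE/map_DtM. Qed.

Lemma DtxD : {morph @Dtx k : u v / u + v}.
Proof. exact: frac_derD map_DtD map_DtM. Qed.

Lemma DtxM u v : @Dtx k (u * v) = Dtx u * v + u * Dtx v.
Proof. by apply: frac_derM => x y; rewrite map_DtM. Qed.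

Lemma Qx_quot (q : k) (a b : {poly ratfun k}) : q != 0 -> b != 0 ->
  Qx q (a%:F / b%:F) =
  (a \Po (frac_cst q *: 'X))%:F / (b \Po (frac_cst q *: 'X))%:F.
Proof.
move=> q0; pose h := [the {rmorphism _ -> _} of
  @FracField.tofrac {poly ratfun k} \o comp_poly (frac_cst q *: 'X)].
have Q0 : frac_cst q != 0 by rewrite tofrac_eq0 polyC_eq0.
apply: (@frac_liftE _ _ h); apply: raddf_inj => p /= /eqP.
rewrite tofrac_eq0 -size_poly_eq0 size_comp_poly2 ?size_scale ?size_polyX //.
by rewrite size_poly_eq0 => /eqP.
Qed.

Lemma frac_map_quot (E : fieldType) (h : {rmorphism k -> E}) (a b : {poly k}) :
  b != 0 ->
  frac_map h (a%:F / b%:F) = (map_poly h a)%:F / (map_poly h b)%:F.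
Proof.
pose H := [the {rmorphism _ -> _} of
  @FracField.tofrac {poly E} \o map_poly h].
apply: (@frac_liftE _ _ H); apply: raddf_inj => p /= /eqP.
by rewrite tofrac_eq0 map_poly_eq0 => /eqP.
Qed.

End OperatorQuotients.

(* Main.v *)
Require Import Defs.
From mathcomp Require Import all_boot all_order all_algebra.
From mathcomp Require Import ring.
From Stdlib Require Import Classical.

Set Implicit Arguments.
Unset Strict Implicit.
Unset Printing Implicit Defensive.

Import GRing.Theory.
Local Open Scope ring_scope.

(** Work with the poles, in K, of elements of k(t)(x).  Let [beta] be a pole of
    f and p its minimal polynomial over k(t).  Either the coefficients of p are
    killed by D_t, hence lie in k, and [beta] is in k because k is algebraically
    closed; or D_t p does not vanish at [beta], so each application of D_t raises
    the order of the p-adic pole of f by exactly one and L(f) still has a pole at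
    [beta].  In the second case [beta] is the only pole of L(f) in its q-orbit.
    If L(f) = g(qx) - g(x), regularity of g at q^i beta and at q^(i+1) beta are
    equivalent for i <> 0; as g has finitely many poles, it is regular on the
    whole orbit, hence L(f) is regular at [beta], a contradiction.
    Conversely, if all poles are in k then f = s / B where D_t B = 0, so all
    D_t^l f = (D_t^l s) / B lie in a finite-dimensional k(t)-space, and some
    L <> 0 annihilates f: take g = 0. *)

(** * Arithmetic of fractions over an integral domain *)

Section Quotients.
Variable R : idomainType.
Implicit Types a b : R.

Lemma quotD a b a' b' : b != 0 -> b' != 0 ->
  a%:F / b%:F + a'%:F / b'%:F = (a * b' + a' * b)%:F / (b * b')%:F.
Proof. by move=> b0 b'0; rewrite addf_div ?tofrac_eq0 // tofracD !tofracM. Qed.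

Lemma quotM a b a' b' :
  a%:F / b%:F * (a'%:F / b'%:F) = (a * a')%:F / (b * b')%:F.
Proof. by rewrite mulf_div !tofracM. Qed.

Lemma quot_eqP a b a' b' : b != 0 -> b' != 0 ->
  a%:F / b%:F = a'%:F / b'%:F <-> a * b' = a' * b.
Proof.
move=> b0 b'0; split=> [/eqP|e].
  rewrite eqr_div ?tofrac_eq0 // -[_ * _]tofracM -[_ * b%:F]tofracM tofrac_eq.
  by move/eqP.
by apply/eqP; rewrite eqr_div ?tofrac_eq0 // -[_ * _]tofracM e tofracM.
Qed.

Lemma quot0 b : 0%:F / b%:F = 0 :> {fraction R}.
Proof. by rewrite tofrac0 mul0r. Qed.

Lemma quot_integral a b c : b != 0 -> a%:F / b%:F = c%:F -> a = c * b.
Proof.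
by move=> b0 e; apply/eqP; rewrite -tofrac_eq tofracM -e divfK ?tofrac_eq0.
Qed.

Lemma quot_pow a b c n (u : {fraction R}) : c != 0 ->
  u * c%:F ^+ n = a%:F / b%:F -> u = a%:F / (b * c ^+ n)%:F.
Proof.
move=> c0 e; have cn0 : c%:F ^+ n != 0 by rewrite expf_neq0 ?tofrac_eq0.
by apply: (mulIf cn0); rewrite e tofracM tofracXn invfM mulrA divfK.
Qed.
End Quotients.

(** * Regularity and pole orders at a point of an extension field *)

Section Poles.
Variables (F E : fieldType) (h : {rmorphism F -> E}).
Implicit Types (a b p r : {poly F}) (u v : ratfun F) (z : E).

(** Any representation of [u] is allowed, not only the reduced one, so sums and products need no
    reduction. Only the point [z] lives in the extension [E]; [u] stays over [F]. *)
Definition regular_at z u : Prop :=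
  exists a, exists2 b, ~~ root (map_poly h b) z & u = a%:F / b%:F.

Lemma nroot_neq0 z a : ~~ root (map_poly h a) z -> a != 0.
Proof.
by apply: contraNneq => ->; rewrite rmorph0 root0.
Qed.

Lemma nroot_mul z a b : ~~ root (map_poly h a) z -> ~~ root (map_poly h b) z ->
  ~~ root (map_poly h (a * b)) z.
Proof. by move=> ha hb; rewrite rmorphM rootM negb_or ha hb. Qed.

Lemma regular_poly z a : regular_at z a%:F.
Proof. by exists a, 1; rewrite rmorph1 ?root1 ?divr1. Qed.

Lemma regularD z u v : regular_at z u -> regular_at z v -> regular_at z (u + v).
Proof.
move=> [a [b hb ->]] [a' [b' hb' ->]].
exists (a * b' + a' * b), (b * b'); first exact: nroot_mul.
by rewrite (quotD _ _ (nroot_neq0 hb) (nroot_neq0 hb')).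
Qed.

Lemma regularM z u v : regular_at z u -> regular_at z v -> regular_at z (u * v).
Proof.
move=> [a [b hb ->]] [a' [b' hb' ->]].
exists (a * a'), (b * b'); first exact: nroot_mul.
by rewrite quotM.
Qed.

Lemma regularN z u : regular_at z u -> regular_at z (- u).
Proof.
by move=> [a [b hb ->]]; exists (- a), b => //; rewrite tofracN mulNr.
Qed.

Lemma regularB z u v : regular_at z u -> regular_at z v -> regular_at z (u - v).
Proof. by move=> hu hv; apply/regularD/regularN. Qed.

Lemma regular_cst z (c : F) : regular_at z (frac_cst c).
Proof. exact: regular_poly. Qed.

Lemma regular_sum z (I : Type) (s : seq I) (P : pred I) (G : I -> ratfun F) :
  (forall i, P i -> regular_at z (G i)) ->
  regular_at z (\sum_(i <- s | P i) G i).
Proof.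
move=> hG; elim/big_ind: _ => //; first by rewrite -tofrac0; apply: regular_poly.
exact: regularD.
Qed.

Lemma coprime_quot u :
  exists a, exists b, [/\ b != 0, coprimep a b & u = a%:F / b%:F].
Proof.
rewrite (frac_reprE u); move: (repr_den_neq0 u); move: (\n_ _) (\d_ _) => a b b0.
have g0 : gcdp a b != 0 by rewrite gcdp_eq0 (negPf b0) andbF.
have ha := divpK (dvdp_gcdl a b); have hb := divpK (dvdp_gcdr a b).
exists (a %/ gcdp a b), (b %/ gcdp a b); split.
- by rewrite dvdp_div_eq0 // dvdp_gcdr.
- by apply: coprimep_div_gcd; rewrite b0 orbT.
apply/quot_eqP => //; first by rewrite dvdp_div_eq0 // dvdp_gcdr.
have := mulrAC (a %/ gcdp a b) (gcdp a b) (b %/ gcdp a b).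
by rewrite ha -mulrA hb.
Qed.

(** After cross-multiplication with a denominator not vanishing at [z], a root [z] of [b] would also
    be a root of [a], against coprimality. *)
Lemma regular_coprime z a b : b != 0 -> coprimep a b ->
  regular_at z (a%:F / b%:F) -> ~~ root (map_poly h b) z.
Proof.
move=> b0 cab [c [d hd]] /(quot_eqP _ _ b0 (nroot_neq0 hd)) e.
apply/negP => rb; move: cab; rewrite -(coprimep_map h) coprimep_sym.
move=> /coprimep_root /(_ rb) /negP[].
have : root (map_poly h (a * d)) z by rewrite e rmorphM rootM rb orbT.
by rewrite rmorphM rootM (negPf hd) orbF.
Qed.

(** The order is counted in powers of [p], in practice the minimal polynomial of [z] over [F],
    rather than of [x - z], so that all computations stay over [F]. *)
Definition pole_of_order p z n u : Prop :=
  exists a, exists b, [/\ ~~ root (map_poly h a) z, ~~ root (map_poly h b) z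
    & u * p%:F ^+ n = a%:F / b%:F].

Section PoleOrder.
Variables (p : {poly F}) (z : E).
Hypothesis pz : root (map_poly h p) z.

Lemma pole_nregular n u : pole_of_order p z n.+1 u -> ~ regular_at z u.
Proof.
move=> [a [b [ha hb eu]]] [c [d hd eu']]; move: eu.
rewrite {}eu' mulrAC -tofracXn -[_ * (p ^+ _)%:F]tofracM.
move=> /(quot_eqP _ _ (nroot_neq0 hd) (nroot_neq0 hb)) e; move: (nroot_mul ha hd); rewrite -e exprS.
by rewrite !rmorphM !rootM pz !orbT.
Qed.

(** Multiplied by [p ^+ n.+1], the summand [v] has a numerator divisible by [p], which vanishes at
    [z]; the value of the numerator of [u] survives. *)
Lemma poleD n u v : regular_at z (v * p%:F ^+ n) ->
  pole_of_order p z n.+1 u -> pole_of_order p z n.+1 (v + u).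
Proof.
move=> [c [d hd ev]] [a [b [ha hb eu]]].
exists (p * c * b + a * d), (d * b); split; last first.
- rewrite mulrDl eu exprSr mulrA ev [_ * p%:F]mulrC mulrA -[p%:F * _]tofracM.
  exact: quotD (nroot_neq0 hd) (nroot_neq0 hb).
- exact: nroot_mul.
rewrite rmorphD rootE hornerD.
rewrite !rmorphM !hornerM (eqP pz) !mul0r add0r -hornerM -rmorphM.
exact: nroot_mul.
Qed.

Lemma pole_regular n m u : (n <= m)%N ->
  pole_of_order p z n u -> regular_at z (u * p%:F ^+ m).
Proof.
move=> /subnK <- [a [b [ha hb e]]]; rewrite addnC exprD mulrA e.
apply: regularM; last by rewrite -tofracXn; apply: regular_poly.
by exists a, b.
Qed.

Lemma poleZ n u (c : F) : c != 0 ->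
  pole_of_order p z n u -> pole_of_order p z n (frac_cst c * u).
Proof.
move=> c0 [a [b [ha hb e]]]; exists (c%:P * a), b; split=> //.
  by apply: nroot_mul; rewrite // map_polyC rootC fmorph_eq0.
by rewrite -mulrA e mulrA -[_ * a%:F]tofracM.
Qed.

Hypothesis p_min : forall r, root (map_poly h r) z -> p %| r.

Lemma factor_out r : r != 0 ->
  exists n, exists2 s, ~~ root (map_poly h s) z & r = s * p ^+ n.
Proof.
(* A nonzero polynomial with a root is not constant, so each division by [p] lowers the size and the
   induction terminates. *)
have p0 : p != 0 -> (1 < size p)%N.
  move=> p0; have := root_size_gt1 _ pz.
  by rewrite size_map_poly map_poly_eq0; apply.
elim: {r}_.+1 {-2}r (ltnSn (size r)) => // N IH r rN r0.
case: (boolP (root (map_poly h r) z)) => [/p_min/divpK e|nr]; last first.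
  by exists 0%N, r; rewrite ?expr0 ?mulr1.
have /andP[q0 pn0] : (r %/ p != 0) && (p != 0) by rewrite -negb_or -mulf_eq0 e.
have lt : (size (r %/ p)%R < N)%N.
  move: rN; rewrite ltnS -{1}e size_mul //; apply: leq_trans.
  by case: (size p) (p0 pn0) => [|[|s]] // _; rewrite !addnS ltnS leq_addr.
have [n [s hs es]] := IH _ lt q0.
by exists n.+1, s => //; rewrite exprSr mulrA -es e.
Qed.

(** In lowest terms the order is the exponent of [p] in the denominator; it is positive because the
    denominator vanishes at [z]. *)
Lemma nregular_pole u : ~ regular_at z u -> exists n, pole_of_order p z n.+1 u.
Proof.
have [a [b [b0 cab ->]]] := coprime_quot u => nreg.
have rb : root (map_poly h b) z.
  by apply/negPn/negP => nr; apply: nreg; exists a, b.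
have [[|n] [s hs es]] := factor_out b0.
  by move: hs rb; rewrite es mulr1 => /negPf ->.
exists n, a, s; split=> //.
  rewrite -(coprimep_map h) coprimep_sym in cab.
  exact: coprimep_root cab rb.
have : b%:F != 0 by rewrite tofrac_eq0.
rewrite es tofracM tofracXn mulf_eq0 negb_or => /andP[s0 p0].
by rewrite invfM mulrA divfK.
Qed.
End PoleOrder.
End Poles.

(** A nonzero annihilator of least size divides all others, since a nonzero remainder would be a
    smaller one. It is made monic so that [Dt] lowers its degree. *)
Lemma minimal_annihilator (F E : fieldType) (h : {rmorphism F -> E}) (z : E) :
  algebraicOver h z -> exists p, [/\ p \is monic, root (map_poly h p) z &
    forall r, root (map_poly h r) z -> p %| r].
Proof.
case=> p0 p0N p0z.
have [p [pN pz pmin]] : exists p, [/\ p != 0, root (map_poly h p) z &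
    forall r, r != 0 -> root (map_poly h r) z -> (size p <= size r)%N].
  elim: {p0}_.+1 {-2}p0 (ltnSn (size p0)) p0N p0z => // N IH p0 lt p0N p0z.
  have [[r [rN rz rp]]|noex] := classic (exists r, [/\ r != 0,
      root (map_poly h r) z & (size r < size p0)%N]).
    exact: IH (leq_trans rp lt) rN rz.
  exists p0; split=> // r rN rz; rewrite leqNgt; apply/negP => rp.
  by apply: noex; exists r.
have lN : (lead_coef p)^-1 != 0 by rewrite invr_eq0 lead_coef_eq0.
exists ((lead_coef p)^-1 *: p); split.
- by rewrite monicE lead_coefZ mulVf ?lead_coef_eq0.
- by rewrite map_polyZ rootZ // fmorph_eq0.
move=> r rz; rewrite dvdpZl // /dvdp; apply/negPn/negP => mN.
have := pmin _ mN; rewrite leqNgt ltn_modp pN; move=> /(_ _)/negP; apply.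
  move: rz; rewrite {1}(divp_eq r p) rmorphD rmorphM !rootE hornerD hornerM.
  by rewrite (eqP pz) mulr0 add0r.
by [].
Qed.

(** * Constants of the derivation and its effect on poles *)

Section Derivations.
Variables (k : fieldType) (E : fieldType).
Hypothesis char0 : [pchar k] =i pred0.
Variable iota : {rmorphism ratfun k -> E}.
Notation kt := (ratfun k).
Notation ktx := (ratfun kt).
Notation D := (map_poly (@Dt k)).
Implicit Types (p a b : {poly kt}) (f : ktx) (z : E).

Let cst : {rmorphism k -> kt} := [the {rmorphism _ -> _} of
  @FracField.tofrac {poly k} \o polyC].

Lemma nat_neq0 n : n.+1%:R != 0 :> E.
Proof.
have -> : n.+1%:R = iota (cst n.+1%:R) by rewrite !rmorph_nat.
by rewrite !fmorph_eq0 (pcharf0P k).1.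
Qed.

Lemma Dt1 : @Dt k 1 = 0.
Proof.
by apply: (addrI (Dt 1)); rewrite addr0 -[in RHS](mulr1 1) DtM mulr1 mul1r.
Qed.

Lemma deriv_eq0 (r : {poly k}) : r^`() = 0 -> r = (r`_0)%:P.
Proof.
move=> r0; apply/polyP => -[|i]; rewrite coefC //=.
have := congr1 (fun s : {poly k} => s`_i) r0; rewrite /= coef_deriv coef0.
by move/eqP; rewrite -mulr_natr mulf_eq0 (pcharf0P k).1 // orbF => /eqP.
Qed.

(** In lowest terms [a' b = a b'] gives [b %| b'], so [b' = 0] by degree and then [a' = 0]; in
    characteristic zero both are constant. *)
Lemma Dt_eq0 (u : kt) : Dt u = 0 -> exists c, u = frac_cst c.
Proof.
have [a [b [b0 cab ->]]] := @coprime_quot k u.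
rewrite Dt_quot // => /eqP; rewrite mulf_eq0 invr_eq0 !tofrac_eq0.
rewrite sqrf_eq0 (negPf b0) orbF subr_eq0 => /eqP e.
have db : b^`() = 0.
  apply/eqP; apply: contraTT (lt_size_deriv b0) => db0; rewrite -leqNgt.
  apply: dvdp_leq => //; have : b %| a * b^`() by rewrite -e dvdp_mull.
  by rewrite Gauss_dvdpr // coprimep_sym.
have da : a^`() = 0.
  by move/eqP: e; rewrite db mulr0 mulf_eq0 (negPf b0) orbF => /eqP.
rewrite (deriv_eq0 da) (deriv_eq0 db); exists (a`_0 / b`_0).
by rewrite -[frac_cst _]/(cst _) fmorph_div.
Qed.

Lemma map_Dt_eq0 p : D p = 0 -> exists s : {poly k}, p = map_poly cst s.
Proof.
elim/poly_ind: p => [|p c IH] e; first by exists 0; rewrite rmorph0.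
have ec i : Dt (p * 'X + c%:P)`_i = 0 by rewrite -coef_map_Dt e coef0.
have [|p0 ->] := IH.
  apply/polyP => i; rewrite coef0 coef_map_Dt.
  by have := ec i.+1; rewrite coefD coefMX coefC addr0.
have [|c0 ->] := @Dt_eq0 c.
  by have := ec 0%N; rewrite coefD coefMX coefC add0r.
exists (p0 * 'X + c0%:P).
by rewrite rmorphD rmorphM /= map_polyX map_polyC.
Qed.

Lemma map_DtX p n : D (p ^+ n.+1) = n.+1%:R * p ^+ n * D p.
Proof.
elim: n => [|n IH]; first by rewrite expr1 expr0 !mul1r.
rewrite exprS map_DtM IH -(addn1 n.+1) natrD !exprS; move: (n.+1%:R) => c.
by ring.
Qed.

Lemma Dtx_regular z f : regular_at iota z f -> regular_at iota z (Dtx f).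
Proof.
move=> [a [b hb ->]]; rewrite Dtx_quot ?(nroot_neq0 hb) //.
by eexists; eexists; last by []; rewrite expr2; apply: nroot_mul.
Qed.

(** Differentiating [p ^+ n.+1] in the denominator gives the one term of the new numerator without a
    factor [p]. It is nonzero at [z] because [n.+1] is nonzero in characteristic zero. *)
Lemma Dtx_pole p z n f : root (map_poly iota p) z ->
  ~~ root (map_poly iota (D p)) z ->
  pole_of_order iota p z n.+1 f -> pole_of_order iota p z n.+2 (Dtx f).
Proof.
move=> pz Dpz [a [b [ha hb e]]].
have p0 : p != 0.
  by apply: contraNneq Dpz => ->; rewrite map_poly0 rmorph0 root0.
have b0 := nroot_neq0 hb.
rewrite (quot_pow p0 e) {e}.
rewrite Dtx_quot ?mulf_neq0 ?expf_neq0 // map_DtM map_DtX.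
(* The quotient rule for [a / (b * p ^+ n.+1)], with the common factor [p ^+ n] cancelled. *)
exists (D a * b * p - a * D b * p - n.+1%:R * a * b * D p), (b * b); split.
- rewrite rmorphB rootE hornerD hornerN.
  rewrite rmorphB !rmorphM !hornerE (eqP pz) !mulr0 subr0 sub0r oppr_eq0.
  rewrite rmorph_nat -[_%:R]polyC_natr hornerC !mulf_neq0 ?nat_neq0 //.
- exact: nroot_mul.
rewrite -tofracXn mulrAC -[_ * (p ^+ _)%:F]tofracM.
apply/quot_eqP; rewrite ?(expf_neq0, mulf_neq0) //.
by rewrite !exprS; ring.
Qed.

(** The derivatives of [f] have strictly increasing pole orders, so the leading term of [L] cannot
    be cancelled. *)
Lemma diffop_pole (L : diffop k) p z n f : root (map_poly iota p) z ->
  ~~ root (map_poly iota (D p)) z -> L != 0 ->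
  pole_of_order iota p z n.+1 f ->
  exists N, pole_of_order iota p z N.+1 (diffop_app L f).
Proof.
move=> pz Dpz L0 fp.
have it l : pole_of_order iota p z (l + n).+1 (iter l (@Dtx k) f).
  by elim: l => //= l; rewrite addSn; apply: Dtx_pole.
have := L0; rewrite -lead_coef_eq0 lead_coefE /diffop_app.
(* Here [s] is the degree of [L]. *)
move: L0; rewrite -size_poly_eq0; case: (size L) => //= s _ Ls; exists (s + n)%N.
rewrite big_ord_recr; apply: poleD => //; last exact: poleZ.
rewrite mulr_suml; apply: regular_sum => l _.
rewrite -mulrA; apply: regularM; first exact: regular_cst.
by apply: pole_regular (it l); rewrite // -addSn leq_add2r.
Qed.

End Derivations.

(** * Poles of partial fractions *)

Section PartialFractions.
Variables (K : fieldType) (beta : K).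
Local Notation id_K := (GRing.RMorphism.clone _ _ (@idfun K) _).
Implicit Types (a : K) (z : K).

Lemma linear_frac : 'X%:F - frac_cst beta = ('X - beta%:P)%:F.
Proof. by rewrite tofracB. Qed.

Lemma simple_fraction_regular z a j : z != beta ->
  regular_at id_K z (frac_cst a / ('X%:F - frac_cst beta) ^+ j).
Proof.
move=> zb; rewrite linear_frac -tofracXn; exists a%:P, (('X - beta%:P) ^+ j) => //.
by rewrite map_poly_id // rootE horner_exp hornerXsubC expf_neq0 // subr_eq0.
Qed.

Lemma principal_part_pole (a : nat -> K) n : a n.+1 != 0 ->
  pole_of_order id_K ('X - beta%:P) beta n.+1
   (\sum_(1 <= j < n.+2) frac_cst (a j) / ('X%:F - frac_cst beta) ^+ j).
Proof.
have p0 : ('X - beta%:P)%:F != 0 by rewrite tofrac_eq0 polyXsubC_eq0.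
move=> an; rewrite big_nat_recr //=; apply: poleD.
- by rewrite map_poly_id // root_XsubC.
- rewrite mulr_suml big_nat_cond; apply: regular_sum => j; rewrite andbT.
  rewrite ltnS => /andP[_ /subnK <-]; rewrite linear_frac addnC exprD mulrA.
  rewrite divfK ?expf_neq0 // -tofracXn.
  by apply: regularM; apply: regular_poly.
exists (a n.+1)%:P, 1; split.
- by rewrite map_polyC rootC.
- by rewrite rmorph1 root1.
by rewrite linear_frac divfK ?expf_neq0 // rmorph1 divr1.
Qed.
End PartialFractions.

(** Coprimality survives base change, so one reduced denominator decides regularity on both
    sides. *)
Lemma regular_frac_map (F E : fieldType) (h : {rmorphism F -> E}) z u :
  regular_at h z u <->
  regular_at (GRing.RMorphism.clone _ _ (@idfun E) _) z (frac_map h u).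
Proof.
have [a [b [b0 cab ->]]] := coprime_quot u.
rewrite frac_map_quot //; split=> [/regular_coprime nb|].
  by exists (map_poly h a), (map_poly h b); rewrite // (@map_poly_id _ idfun) // nb.
move/regular_coprime; rewrite map_poly_eq0 coprimep_map => /(_ b0 cab).
by rewrite map_poly_id // => nb; exists a, b.
Qed.

(** A nonzero [r] has fewer roots than [size r], so one of the first [size r] points is not a
    root. *)
Lemma exists_nroot (E : idomainType) (r : {poly E}) (s : nat -> E) :
  injective s -> r != 0 -> exists n, ~~ root r (s n).
Proof.
move=> sI r0; have := @max_poly_roots _ r (mkseq s (size r)) r0.
rewrite size_mkseq ltnn mkseq_uniq //.
case: allP => [_ /(_ isT isT)//|nall _].
apply: NNPP => nex; apply: nall => _ /mapP[i _ ->].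
by apply/negPn/negP => nr; apply: nex; exists i.
Qed.

Lemma comp_polyK (R : comNzRingType) (r s t : {poly R}) :
  s \Po t = 'X -> (r \Po s) \Po t = r.
Proof. by move=> st; rewrite -comp_polyA st comp_polyXr. Qed.

(** * The q-shift and regularity *)

Section Shift.
Variables (k : fieldType) (q : k).
Hypothesis q_neq0 : q != 0.
Variables (E : fieldType) (iota : {rmorphism ratfun k -> E}).
Notation ktx := (ratfun (ratfun k)).
Notation qE := (iota (frac_cst q)).
Implicit Types (g u : ktx) (z : E).

Lemma frac_cst_neq0 (F : fieldType) (c : F) : c != 0 -> frac_cst c != 0.
Proof. by rewrite tofrac_eq0 polyC_eq0. Qed.

Lemma frac_cstV (F : fieldType) (c : F) : frac_cst c^-1 = (frac_cst c)^-1.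
Proof.
exact: (fmorphV [the {rmorphism F -> ratfun F} of
  @FracField.tofrac {poly F} \o polyC]).
Qed.

Lemma Qx0 : Qx q 0 = 0.
Proof.
transitivity (Qx q (0%:F / 1%:F)); first by rewrite quot0.
rewrite Qx_quot ?oner_neq0 //; apply: etrans (quot0 _).
by congr (_%:F / _); apply: comp_poly0.
Qed.

Lemma QxK g : Qx q^-1 (Qx q g) = g.
Proof.
have Q0 := frac_cst_neq0 q_neq0.
rewrite (frac_reprE g); move: (repr_den_neq0 g).
move: (\n_ _) (\d_ _) => a b b0.
have comp0 : b \Po (frac_cst q *: 'X) != 0.
  rewrite -size_poly_eq0 size_comp_poly2 ?size_scale ?size_polyX //.
  by rewrite size_poly_eq0.
have QV : (frac_cst q *: 'X) \Po (frac_cst q^-1 *: 'X) = 'X.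
  by rewrite comp_polyZ comp_polyX scalerA frac_cstV mulfV // scale1r.
rewrite (Qx_quot a q_neq0 b0) Qx_quot ?invr_eq0 //.
by congr (_%:F / _%:F); apply: comp_polyK QV.
Qed.

Lemma Qx_regular z g : regular_at iota (qE * z) g -> regular_at iota z (Qx q g).
Proof.
move=> [a [b hb ->]]; rewrite Qx_quot ?(nroot_neq0 hb) //.
exists (a \Po (frac_cst q *: 'X)), (b \Po (frac_cst q *: 'X)) => //.
by rewrite rootE map_comp_poly map_polyZ map_polyX horner_comp hornerZ hornerX.
Qed.
End Shift.

(** The converse of [Qx_regular] is [Qx_regular] itself for [q^-1], applied to [Qx q g]. *)
Lemma Qx_regularE (k : fieldType) (q : k) (E : fieldType)
  (iota : {rmorphism ratfun k -> E}) z g : q != 0 ->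
  regular_at iota z (Qx q g) <-> regular_at iota (iota (frac_cst q) * z) g.
Proof.
move=> q0; split=> [hg|]; last exact: Qx_regular.
rewrite -(QxK q0 g); apply: Qx_regular; rewrite ?invr_eq0 //.
by rewrite frac_cstV fmorphV mulKf // fmorph_eq0 frac_cst_neq0.
Qed.

(** * Regularity along a q-orbit *)

Section Orbit.
Variables (k : fieldType) (q : k).
Hypotheses (q_neq0 : q != 0) (q_nroot : forall i : int, i != 0 -> q ^ i != 1).
Variables (E : fieldType) (iota : {rmorphism ratfun k -> E}).
Notation ktx := (ratfun (ratfun k)).
Notation qE := (iota (frac_cst q)).
Implicit Types (g u : ktx) (z : E).

Lemma qE_neq0 : qE != 0.
Proof. by rewrite fmorph_eq0 frac_cst_neq0. Qed.

Lemma qE_nroot (i : int) : i != 0 -> qE ^ i != 1.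
Proof.
move=> i0; have := q_nroot i0.
pose c := [the {rmorphism k -> E} of
  iota \o [the {rmorphism _ -> _} of @FracField.tofrac {poly k} \o polyC]].
by rewrite -(inj_eq (fmorph_inj c)) fmorphXz rmorph1.
Qed.

Lemma orbit_inj z : z != 0 -> injective (fun i : int => qE ^ i * z).
Proof.
move=> z0 i j /(mulIf z0) e; apply/eqP; rewrite -subr_eq0; apply/negPn/negP.
move=> /qE_nroot /negP; apply; rewrite expfzDr ?qE_neq0 // e -expfzDr ?qE_neq0 //.
by rewrite subrr.
Qed.

Lemma exists_regular g (s : nat -> E) :
  injective s -> exists n, regular_at iota (s n) g.
Proof.
move=> sI; rewrite (frac_reprE g); move: (repr_den_neq0 g).
move: (\n_ _) (\d_ _) => a b b0.
have [|n hn] := @exists_nroot E (map_poly iota b) s sI; first by rewrite map_poly_eq0.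
by exists n, a, b.
Qed.

(** The orbit is cut between the indices 0 and 1, the only link not controlled by the hypothesis;
    each half is treated separately. *)
Lemma regular_Deltax g z : z != 0 ->
  (forall i : int, i != 0 -> regular_at iota (qE ^ i * z) (Deltax q g)) ->
  regular_at iota z (Deltax q g).
Proof.
move=> z0 hD; pose R i := regular_at iota (qE ^ i * z) g.
have Q i : regular_at iota (qE ^ i * z) (Qx q g) <-> R (i + 1).
  by rewrite Qx_regularE // /R addrC expfzDr ?qE_neq0 // expr1z mulrA.
have step i : i != 0 -> R i <-> R (i + 1).
  move=> i0; rewrite -Q; have h := hD i i0; split=> hR.
    by rewrite -(subrK g (Qx q g)); apply: regularD.
  by rewrite /R -[X in regular_at _ _ X](subKr (Qx q g)); apply: regularB.
have down (P : nat -> Prop) n : (forall n, P n.+1 -> P n) -> P n -> P 0%N.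
  by move=> hP; elim: n => // n IH /hP.
(* Some point of positive index is regular for [g]; descend from it to index 1. *)
have R1 : R 1.
  have [|n hn] := @exists_regular g (fun n : nat => qE ^ n.+1%:Z * z).
    by move=> i j /(orbit_inj z0)[].
  apply: (down (fun n => R n.+1%:Z) n) hn => i hi.
  by apply/(step i.+1%:Z); rewrite // -PoszD addn1.
(* On the other half, climb from a regular point of index at most 0; the last link used is from -1
   to 0. *)
have R0 : R 0.
  have [|n hn] := @exists_regular g (fun n : nat => qE ^ (- n%:Z) * z).
    by move=> i j /(orbit_inj z0)/oppr_inj[].
  apply: (down (fun n => R (- n%:Z)) n) hn => i /(step (- i.+1%:Z) isT).1.
  by rewrite -addn1 PoszD opprD subrK.
have e : qE ^ 0 * z = z by rewrite expr0z mul1r.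
by rewrite -e; apply: regularB => //; apply/Q; rewrite add0r.
Qed.
End Orbit.

(** * Constant and moving points *)

Section Moving.
Variables (k : closedFieldType) (K : fieldType).
Hypothesis char0 : [pchar k] =i pred0.
Variable iota : {rmorphism ratfun k -> K}.
Notation D := (map_poly (@Dt k)).

Lemma constant_or_moving (z : K) : algebraicOver iota z ->
  (exists b : k, z = iota (frac_cst b)) \/
  exists p, [/\ root (map_poly iota p) z, ~~ root (map_poly iota (D p)) z &
    forall r, root (map_poly iota r) z -> p %| r].
Proof.
move=> /minimal_annihilator[p [pm pz pmin]].
have [Dp0|DpN] := eqVneq (D p) 0; last first.
  right; exists p; split=> //; apply/negP => /pmin /(dvdp_leq DpN).
  have sp : (0 < size p)%N by rewrite size_poly_gt0 monic_neq0.
  apply/negP; rewrite -ltnNge.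
  (* The leading coefficient of [p] is 1 and has derivative 0, so [D p] is smaller than [p] and
     cannot be a multiple of it. *)
  rewrite -(prednK sp) ltnS; apply/leq_sizeP => j; rewrite leq_eqVlt.
  rewrite coef_map_Dt => /orP[/eqP <-|].
    by rewrite -lead_coefE (eqP pm) Dt1.
  by rewrite (prednK sp) => /leq_sizeP -> //; rewrite Dt0.
(* Now [p] comes from a polynomial [s] over [k], which splits there; [z] is the image of one of its
   roots. *)
left; have [s ps] := map_Dt_eq0 char0 Dp0.
have [rs es] := closed_field_poly_normal s.
move: pz; rewrite ps -map_poly_comp /=.
have s0 : s != 0.
  apply: contraTneq pm => s0.
  by rewrite ps s0 rmorph0 monicE lead_coef0 eq_sym oner_eq0.
rewrite es; set c : {rmorphism k -> K} := [the {rmorphism k -> K} of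
  iota \o [the {rmorphism _ -> _} of @FracField.tofrac {poly k} \o polyC]].
rewrite -[map_poly _ _]/(map_poly c _) map_polyZ rootZ ?fmorph_eq0 ?lead_coef_eq0 //.
rewrite rmorph_prod /= (eq_bigr (fun b => 'X - (c b)%:P)); last first.
  by move=> b _; rewrite rmorphB /= map_polyX map_polyC.
rewrite -(big_map c predT (fun b => 'X - b%:P)) root_prod_XsubC.
by case/mapP => b _ ->; exists b.
Qed.

Lemma diffop_regular (L : diffop k) z f :
  regular_at iota z f -> regular_at iota z (diffop_app L f).
Proof.
move=> hf; apply: regular_sum => l _; apply: regularM; first exact: regular_cst.
by elim: (l : nat) => //= i; apply: Dtx_regular.
Qed.
End Moving.

(** The first [N.+1] polynomials lie in a space of dimension [N]; a vector in the left kernel of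
    their matrix supplies the coefficients of [L]. *)
Lemma bounded_dependent (F : fieldType) (V : nat -> {poly F}) N :
  (forall l, (size (V l) <= N)%N) ->
  exists2 L : {poly F}, L != 0 & \sum_(l < size L) L`_l *: V l = 0.
Proof.
move=> sV; pose M := \matrix_(l < N.+1) poly_rV (V l) : 'M_(N.+1, N).
pose v := nz_row (kermx M).
have v0 : v != 0.
  rewrite nz_row_eq0 -mxrank_eq0 mxrank_ker -lt0n subn_gt0 ltnS.
  exact: rank_leq_col.
have vM : v *m M = 0 by apply/sub_kermxP; apply: nz_row_sub.
have L0 : rVpoly v != 0.
  by apply: contraNneq v0 => v0; rewrite -(rVpolyK v) v0 linear0.
exists (rVpoly v) => //.
(* The matrix product sums over all [N.+1] rows; coefficients beyond [size L] are zero. *)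
rewrite (big_ord_widen _ (fun l => (rVpoly v)`_l *: V l) (size_poly _ _)).
rewrite big_mkcond /= -[RHS](linear0 (@rVpoly F N)) -vM mulmx_sum_row linear_sum.
apply: eq_bigr => l _; rewrite linearZ /= rowK poly_rV_K // coef_rVpoly_ord.
by case: ltnP => // /(nth_default 0); rewrite coef_rVpoly_ord => ->; rewrite scale0r.
Qed.

(** * Annihilating operators for constant denominators *)

Section Summable.
Variables (k : fieldType).
Notation kt := (ratfun k).
Notation D := (map_poly (@Dt k)).
Implicit Types (a B : {poly kt}).

Lemma size_map_Dt a : (size (D a) <= size a)%N.
Proof. exact: size_poly. Qed.

Lemma map_Dt_linear (b : k) : D ('X - (frac_cst b)%:P) = 0.
Proof.
have e : Dt (frac_cst b) = 0.
  rewrite -[frac_cst b]divr1 -tofrac1 Dt_quot ?oner_neq0 //.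
  by rewrite derivC (derivC 1) mul0r mulr0 subrr tofrac0 mul0r.
apply/polyP => i; rewrite coef0 coef_map_Dt coefB coefX coefC.
have eN : Dt (- frac_cst b) = 0.
  by have := DtD (frac_cst b) (- frac_cst b); rewrite subrr Dt0 e add0r.
case: i => [|[|i]] /=; first by rewrite sub0r eN.
  by rewrite subr0; apply: Dt1.
by rewrite subr0 Dt0.
Qed.

Lemma map_Dt_prod0 (I : Type) (s : seq I) (G : I -> {poly kt}) :
  (forall i, D (G i) = 0) -> D (\prod_(i <- s) G i) = 0.
Proof.
move=> G0; elim/big_ind: _ => // [|x y hx hy].
  apply/polyP => i; rewrite coef0 coef_map_Dt coef1.
  by case: (i == 0%N); rewrite ?(@Dt1 k) ?Dt0.
by rewrite map_DtM hx hy mul0r mulr0 addr0.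
Qed.

(** All derivatives keep the denominator [B], and [D] never increases the size of the numerator, so
    [bounded_dependent] applies to the numerators. *)
Lemma diffop_annihilator a B : B != 0 -> D B = 0 ->
  exists2 L : diffop k, L != 0 & diffop_app L (a%:F / B%:F) = 0.
Proof.
move=> B0 DB.
have it l : iter l (@Dtx k) (a%:F / B%:F) = (iter l D a)%:F / B%:F.
  elim: l => //= l ->; rewrite Dtx_quot // DB mulr0 subr0.
  by apply/quot_eqP; rewrite ?expf_neq0 // expr2 mulrA.
have [l|L L0 e] := @bounded_dependent _ (fun l => iter l D a) (size a).
  by elim: l => //= l IH; apply: leq_trans IH; apply: size_map_Dt.
exists L => //; rewrite /diffop_app.
transitivity ((\sum_(l < size L) L`_l *: iter l D a)%:F / B%:F).
  rewrite (big_morph _ (@tofracD _) (@tofrac0 _)) mulr_suml; apply: eq_bigr => l _.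
  by rewrite it mulrA -[_ * _%:F]tofracM mul_polyC.
by rewrite e tofrac0 mul0r.
Qed.
End Summable.

(** * Common denominator of a partial fraction decomposition *)

Section ClearDenominator.
Variables (K : fieldType) (m : nat) (n : 'I_m -> nat).
Variables (alpha : 'I_m -> nat -> K) (beta : 'I_m -> K).

Lemma partial_fractions_quot (c : K) : exists P : {poly K},
  (frac_cst c + \sum_(i < m) \sum_(1 <= j < (n i).+1)
     frac_cst (alpha i j) / ('X%:F - frac_cst (beta i)) ^+ j)
  * (\prod_(i < m) ('X - (beta i)%:P) ^+ n i)%:F = P%:F.
Proof.
set B := \prod_(i < m) _; pose isP (u : ratfun K) := exists P : {poly K}, u = P%:F.
have isPD u v : isP u -> isP v -> isP (u + v).
  by move=> [P ->] [Q ->]; exists (P + Q); rewrite tofracD.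
have isP0 : isP 0 by exists 0; rewrite tofrac0.
rewrite mulrDl; apply: (isPD); first by exists (c%:P * B); rewrite tofracM.
rewrite mulr_suml; apply: (big_ind isP) => // i _.
rewrite mulr_suml big_nat_cond; apply: (big_ind isP) => // j.
rewrite andbT ltnS => /andP[_ /subnKC jn].
rewrite /B (bigD1 i) //= -{1}jn exprD -(mulrA (_ ^+ j)) tofracM linear_frac -tofracXn.
rewrite mulrA divfK; last by rewrite tofrac_eq0 expf_neq0 // polyXsubC_eq0.
by eexists; rewrite -tofracM.
Qed.
End ClearDenominator.

(** * Poles that are alone in their orbit *)

Section IsolatedPole.
Variables (k : closedFieldType) (q : k) (K : fieldType).
Hypotheses (char0 : [pchar k] =i pred0) (q_neq0 : q != 0)
  (q_nroot : forall i : int, i != 0 -> q ^ i != 1).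
Variable iota : {rmorphism ratfun k -> K}.

(** Regularity on the rest of the orbit is asked only for [z != 0]: the orbit of 0 is a single
    point, and 0 is already constant. *)
Lemma isolated_pole_constant (f g : ratfun (ratfun k)) (L : diffop k) (z : K) :
  algebraicOver iota z -> L != 0 -> diffop_app L f = Deltax q g ->
  ~ regular_at iota z f ->
  (forall i : int, i != 0 -> z != 0 ->
     regular_at iota (iota (frac_cst q) ^ i * z) f) ->
  exists b : k, z = iota (frac_cst b).
Proof.
move=> z_alg L0 Lfg nreg reg.
have [->|z0] := eqVneq z 0; first by exists 0; rewrite /frac_cst tofrac0 rmorph0.
have [//|[p [pz Dpz pmin]]] := constant_or_moving char0 z_alg.
have [n fn] := nregular_pole pz pmin nreg.
have [N Lfn] := diffop_pole char0 pz Dpz L0 fn.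
case: (pole_nregular pz Lfn); rewrite Lfg; apply: regular_Deltax => // i i0.
by rewrite -Lfg; apply: diffop_regular; apply: reg.
Qed.
End IsolatedPole.

Theorem theorem4p13 (k : closedFieldType) (char0 : [pchar k] =i pred0)
  (q : k) (q_neq0 : q != 0) (q_nroot : forall i : int, i != 0 -> q ^ i != 1)
  (K : closedFieldType) (iota : {rmorphism ratfun k -> K})
  (K_algebraic : forall u : K, algebraicOver iota u)
  (f : ratfun (ratfun k)) (c : ratfun k)
  (m : nat) (n : 'I_m -> nat) (n_gt0 : forall i, (0 < n i)%N)
  (alpha : 'I_m -> nat -> K) (beta : 'I_m -> K)
  (f_decomp : frac_map iota f = frac_cst (iota c) +
     \sum_(i < m) \sum_(1 <= j < (n i).+1)
        frac_cst (alpha i j) / ('X%:F - frac_cst (beta i)) ^+ j)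
  (alpha_neq0 : forall i, alpha i (n i) != 0)
  (beta_orbits : forall (i i' : 'I_m) (z : int), i != i' ->
     beta i != iota (frac_cst q) ^ z * beta i') :
  (exists L : diffop k, L != 0 /\
     exists g : ratfun (ratfun k), diffop_app L f = Deltax q g)
  <-> (forall i, exists b : k, beta i = iota (frac_cst b)).
Proof.
split=> [[L [L0 [g Lfg]]] i|/fin_all_exists[b hb]].
  have fnE z := regular_frac_map iota z f.
  apply: (isolated_pole_constant char0 q_neq0 q_nroot (K_algebraic _) L0 Lfg).
    (* The other principal parts are regular at [beta i], so the one of index [i], with
       [alpha i (n i)] nonzero, forces a pole of [f]. *)
    move/fnE; rewrite f_decomp (bigD1 i) //= addrCA addrC.
    have root_i : root (map_poly (@idfun K) ('X - (beta i)%:P)) (beta i).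
      by rewrite map_poly_id // root_XsubC.
    move: (alpha_neq0 i); rewrite -(prednK (n_gt0 i)) => /principal_part_pole-/(_ (beta i)) hp.
    apply: (pole_nregular root_i); apply: poleD hp => //.
    apply: regularM; last by rewrite -tofracXn; apply: regular_poly.
    apply: regularD; first exact: regular_cst.
    apply: regular_sum => i' i'i; apply: regular_sum => j _.
    apply: simple_fraction_regular.
    by have := beta_orbits _ _ 0 i'i; rewrite expr0z mul1r eq_sym.
  move=> w w0 bi0; apply/fnE; rewrite f_decomp.
  apply: regularD; first exact: regular_cst.
  apply: regular_sum => i' _; apply: regular_sum => j _.
  apply: simple_fraction_regular; have [->|i'i] := eqVneq i' i.
    (* A nonzero [beta i] is moved by every nontrivial power of [q]. *)
    rewrite -subr_eq0 -{2}[beta i]mul1r -mulrBl mulf_neq0 // subr_eq0.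
    exact: qE_nroot.
  by rewrite eq_sym beta_orbits.
pose B := \prod_(i < m) ('X - (frac_cst (b i))%:P) ^+ n i.
have B0 : B != 0.
  by apply/prodf_neq0 => i _; rewrite expf_neq0 // polyXsubC_eq0.
have DB : map_poly (@Dt k) B = 0.
  apply: map_Dt_prod0 => i; rewrite -(prednK (n_gt0 i)) map_DtX.
  by rewrite map_Dt_linear mulr0.
have [s fs] : exists s, f = s%:F / B%:F.
  have [P] := partial_fractions_quot n alpha beta (iota c).
  rewrite -f_decomp; have [a [d [d0 _ ->]]] := coprime_quot f.
  have -> : \prod_(i < m) ('X - (beta i)%:P) ^+ n i = map_poly iota B.
    rewrite rmorph_prod; apply: eq_bigr => i _.
    by rewrite rmorphXn rmorphB /= map_polyX map_polyC /= hb.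
  rewrite frac_map_quot // mulrAC -[_ * (map_poly _ B)%:F]tofracM => e.
  (* Over [K] the quotient of [a * B] by [d] is the polynomial [P]; divisibility descends along the
     field extension to [ratfun k]. *)
  have : d %| a * B.
    rewrite -(dvdp_map iota) rmorphM; apply/dvdpP; exists P.
    by apply: quot_integral e; rewrite map_poly_eq0.
  move=> /dvdpP[s es]; exists s; exact/quot_eqP.
rewrite fs; have [L L0 Lf] := diffop_annihilator s B0 DB.
by exists L; split=> //; exists 0; rewrite Lf /Deltax Qx0 // subr0.
Qed.
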